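(* Let $K\subset\mathbb{R}^d$ be a convex body and let $X_1,X_2,\dots$ be i.i.d. random points in $K$ with distribution $\mu$. Assume that there are positive numbers $\alpha,L,\varepsilon_0$ with $\varepsilon_0\le 1$ such that $$\mu\left(C_K(u,\varepsilon)\right)\ge L\varepsilon^\alpha\quad\text{for all }u\in\mathbb{S}^{d-1}\text{ and all }\varepsilon\in[0,\varepsilon_0].$$ Let $C>2\alpha^{-1}d^2\,8^{\frac{d-1}{2}}$ and, for $n\ge 2$, let $M=\left\lceil C\,n^{\frac{d-1}{\alpha}}(\ln n)^{\frac{\alpha-d+1}{\alpha}}\right\rceil$. Let $U_1,\dots,U_M$ be i.i.d. uniform random vectors on $\mathbb{S}^{d-1}$, independent of $X_1,\dots,X_n$, and let $$\hat K_{n,M}=\left\{x\in\mathbb{R}^d:\langle U_j,x\rangle\le\max_{1\le i\le n}\langle U_j,X_i\rangle,\ \forall j=1,\dots,M\right\}.$$ Then, as $n\to\infty$, $$\mathsf{d}_{\mathsf H}(\hat K_{n,M},K)=O_{\mathbb{P}}\left(\left(\frac{\ln n}{n}\right)^{1/\alpha}\right).$$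
   Context: $d$ is a positive integer. A convex body in $\mathbb{R}^d$ is a compact convex set with nonempty interior. $\mathbb{S}^{d-1}$ is the Euclidean unit sphere. $h_K(u)=\max\{\langle u,x\rangle:x\in K\}$ is the support function, and $C_K(u,\varepsilon)=\{x\in K:\langle u,x\rangle\ge h_K(u)-\varepsilon\}$. $\mathsf{d}_{\mathsf H}$ is the Hausdorff distance (with value $+\infty$ when $\hat K_{n,M}$ is unbounded). $Z_n=O_{\mathbb{P}}(v_n)$ means that $Z_n/v_n$ is bounded in probability. *)

(* Defs.v *)
From HB Require Import structures.
From mathcomp Require Import all_boot all_order all_algebra finmap.
From mathcomp Require Import all_classical all_reals all_analysis.

Set Implicit Arguments.
Unset Strict Implicit.
Unset Printing Implicit Defensive.

Import Order.TTheory GRing.Theory Num.Theory.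
Import numFieldNormedType.Exports.

Local Open Scope classical_set_scope.
Local Open Scope ring_scope.

(* The ambient norm of the library on row vectors is the sup norm; it is used
   below only through the topology.  All metric notions refer to [enorm]. *)
Definition dot (R : realType) (d : nat) (x y : 'rV[R]_d) : R :=
  \sum_(i < d) x ord0 i * y ord0 i.

Definition enorm (R : realType) (d : nat) (x : 'rV[R]_d) : R :=
  Num.sqrt (dot x x).

Definition sphere (R : realType) (d : nat) : set 'rV[R]_d :=
  [set u | enorm u = 1].

Definition convex_body (R : realType) (d : nat) (K : set 'rV[R]_d) : Prop :=
  [/\ compact K, convex_set K & interior K !=set0].

Definition support_fun (R : realType) (d : nat) (K : set 'rV[R]_d)
    (u : 'rV[R]_d) : R :=
  sup [set dot u x | x in K].

Definition cap (R : realType) (d : nat) (K : set 'rV[R]_d) (u : 'rV[R]_d)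
    (e : R) : set 'rV[R]_d :=
  [set x | K x /\ support_fun K u - e <= dot u x].

(* Takes the value +oo when the supremum is infinite, in particular when
   exactly one of the two sets is bounded and both are nonempty. *)
Definition hausdorff_dist (R : realType) (d : nat) (A B : set 'rV[R]_d)
    : \bar R :=
  let excess (A B : set 'rV[R]_d) : \bar R :=
    ereal_sup [set ereal_inf [set (enorm (x - y))%:E | y in B] | x in A] in
  Order.max (excess A B) (excess B A).

(* R^d with its Borel sigma-algebra. *)
Notation borel_vec R d := (g_sigma_algebraType (@open 'rV[R]_d)).

Section Randomness.
Context (R : realType) (d : nat) (dT : measure_display) (T : measurableType dT)
  (P : probability T R).

Definition has_law (X : {mfun T >-> borel_vec R d})
    (mu : probability (borel_vec R d) R) : Prop :=
  forall A, measurable A -> distribution P X A = mu A.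

Definition mutually_independent (D : set nat)
    (X : nat -> {mfun T >-> borel_vec R d}) : Prop :=
  forall (J : {fset nat}) (A : nat -> set (borel_vec R d)),
    [set` J] `<=` D -> (forall i, measurable (A i)) ->
    P (\bigcap_(i in [set` J]) (X i @^-1` A i)) =
    (\prod_(i <- J) P (X i @^-1` A i))%E.

Definition iid (D : set nat) (X : nat -> {mfun T >-> borel_vec R d})
    (mu : probability (borel_vec R d) R) : Prop :=
  (forall i, D i -> has_law (X i) mu) /\ mutually_independent D X.

Definition sigma_generated (D : set nat)
    (X : nat -> {mfun T >-> borel_vec R d}) : set (set T) :=
  <<s [set E | exists i A, [/\ D i, measurable A & E = X i @^-1` A]] >>.

Definition independent_families (D D' : set nat)
    (X Y : nat -> {mfun T >-> borel_vec R d}) : Prop :=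
  forall E F, sigma_generated D X E -> sigma_generated D' Y F ->
    P (E `&` F) = (P E * P F)%E.

(* Boundedness in probability of |Z_n| / v_n as n -> oo, for v_n > 0.
   The tail event is bounded through a measurable superset, i.e. in outer
   probability; this is the usual notion when the Z_n are measurable. *)
Definition bigO_P (Z : nat -> T -> \bar R) (v : nat -> R) : Prop :=
  forall eta : R, 0 < eta ->
    exists (B : R) (N : nat), forall n, (N <= n)%N ->
      exists E : set T, [/\ measurable E,
        [set w | (B * v n)%:E < `|Z n w|]%E `<=` E & (P E <= eta%:E)%E].

End Randomness.

(* The uniform distribution on the sphere: the unique Borel probability
   measure carried by the sphere that is invariant under O(d). *)
Definition uniform_sphere (R : realType) (d : nat)
    (sigma : probability (borel_vec R d) R) : Prop :=
  sigma (@sphere R d) = 1%E /\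
  forall (Q : 'M[R]_d) (A : set (borel_vec R d)),
    Q *m Q^T = 1%:M -> measurable A ->
    sigma ((fun x : 'rV[R]_d => x *m Q) @^-1` A) = sigma A.

(* For n >= 2 the argument of the ceiling is nonnegative if C >= 0, so that
   taking the absolute value of the integer is harmless. *)
Definition num_dir (R : realType) (d : nat) (alpha C : R) (n : nat) : nat :=
  `|Num.ceil (C * (n%:R `^ ((d%:R - 1) / alpha))
                * (ln n%:R `^ ((alpha - d%:R + 1) / alpha)))|%N.

(* The points and directions are indexed from 0.  For n >= 1 the default value
   of the maximum is its term of index 0. *)
Definition khat (R : realType) (d : nat) (n M : nat) (X U : nat -> 'rV[R]_d)
    : set 'rV[R]_d :=
  [set x | forall j, (j < M)%N ->
     dot (U j) x <= \big[Num.max/dot (U j) (X 0%N)]_(i < n) dot (U j) (X i)].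

(* Main.v *)
Require Import Defs.
From mathcomp Require Import all_boot all_order all_algebra finmap.
From mathcomp Require Import all_classical all_reals all_analysis.
From mathcomp Require Import ring lra.
Import Order.TTheory GRing.Theory Num.Theory.
Import numFieldNormedType.Exports.
Local Open Scope classical_set_scope.
Local Open Scope ring_scope.

Set Implicit Arguments.
Unset Strict Implicit.
Unset Printing Implicit Defensive.

(** Write rho for the rate (ln n / n)^(1/alpha). The random polyhedron is
    within O(rho) of [K] as soon as two things happen: the directions U_j form
    an O(rho)-net of the sphere, and for every j some sample point comes within
    O(rho) of the support value of [K] in the direction U_j. Indeed a point x
    far from [K] is cut off by a direction U_j close to the outer normal at the
    projection of x on [K] (lemma [khat_near_body]). Conversely, moving a point
    of [K] towards the centre of a ball contained in [K], by a fraction O(rho),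
    brings it into the polyhedron (lemma [body_near_khat]).

    Both things are controlled through a deterministic finite net of the sphere
    of radius O(rho), with points v_c. It suffices that every ball around a v_c
    contains some U_j, and that every cap of [K] of direction v_c and depth
    O(rho) contains some sample point: support functions of bounded sets are
    Lipschitz, so the caps in the directions U_j then have points of the sample
    too, up to another O(rho). The second condition mentions only the sample
    and the first only the directions, so each of them is handled separately,
    by a union bound over the net.

    The net must have O(rho^-(d-1)) points (lemma [sphere_net]), with the exact
    dimension of the sphere, because of the size of M. It comes from a grid on
    all the coordinates but one of maximal size. By invariance under O(d), all
    balls of the same radius centred on the sphere have the same mass, hence
    a mass at least 1/N if N balls of this radius cover the sphere (lemma
    [uniform_sphere_ball]). With N <= 2 d rho^-(d-1) and
    M >= C (ln n) rho^-(d-1), a given ball is missed by all the U_j with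
    probability at most exp (- M / N) <= n^(-C / (2 d)) <= n^(-d / alpha).
    A cap of depth b rho is missed by all sample points with probability at most
    exp (- n L (b rho)^alpha) = n^(- L b^alpha), which is n^(-d / alpha) for a
    suitable b. Multiplied by N, both bounds are O(rho) (lemma
    [net_union_bound]), so the probability of failure tends to 0. *)

(** * The Euclidean structure of row vectors *)

Section Euclidean.
Context (R : realType) (d : nat).
Implicit Types (a : R) (x y z : 'rV[R]_d).

Lemma dotC x y : dot x y = dot y x.
Proof. by apply: eq_bigr => i _; rewrite mulrC. Qed.

Lemma dotDr x y z : dot x (y + z) = dot x y + dot x z.
Proof. by rewrite -big_split; apply: eq_bigr => i _; rewrite mxE mulrDr. Qed.

Lemma dotZr a x y : dot x (a *: y) = a * dot x y.
Proof. by rewrite mulr_sumr; apply: eq_bigr => i _; rewrite mxE mulrCA. Qed.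

Lemma dotNr x y : dot x (- y) = - dot x y.
Proof. by rewrite -scaleN1r dotZr mulN1r. Qed.

Lemma dotDl x y z : dot (y + z) x = dot y x + dot z x.
Proof. by rewrite dotC dotDr !(dotC x). Qed.

Lemma dotZl a x y : dot (a *: y) x = a * dot y x.
Proof. by rewrite dotC dotZr dotC. Qed.

Lemma dotNl x y : dot (- y) x = - dot y x.
Proof. by rewrite dotC dotNr dotC. Qed.

Definition dotE := (dotDl, dotDr, dotNl, dotNr, dotZl, dotZr).

Lemma dot_ge0 x : 0 <= dot x x.
Proof. by apply: sumr_ge0 => i _; rewrite -expr2 sqr_ge0. Qed.

Lemma enorm_ge0 x : 0 <= enorm x.
Proof. exact: sqrtr_ge0. Qed.

Lemma enorm_sqr x : enorm x ^+ 2 = dot x x.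
Proof. by rewrite sqr_sqrtr ?dot_ge0. Qed.

Lemma coord_le_enorm x i : `|x ord0 i| <= enorm x.
Proof.
rewrite -sqrtr_sqr ler_sqrt ?dot_ge0// /dot (bigD1 i)//= expr2 lerDl.
by apply: sumr_ge0 => j _; rewrite -expr2 sqr_ge0.
Qed.

Lemma enorm_eq0 x : enorm x = 0 -> x = 0.
Proof.
move=> x0; apply/rowP => i; rewrite mxE; apply/eqP.
by rewrite -normr_le0 -x0 coord_le_enorm.
Qed.

Lemma enormN x : enorm (- x) = enorm x.
Proof. by rewrite /enorm dotNl dotNr opprK. Qed.

Lemma enormB x y : enorm (x - y) = enorm (y - x).
Proof. by rewrite -enormN opprB. Qed.

Lemma enormZ a x : enorm (a *: x) = `|a| * enorm x.
Proof.
by rewrite /enorm dotZl dotZr mulrA -expr2 sqrtrM ?sqr_ge0// sqrtr_sqr.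
Qed.

Lemma dot_le_enorm x y : dot x y <= enorm x * enorm y.
Proof.
have [/enorm_eq0->|x0] := eqVneq (enorm x) 0.
  by rewrite -(scale0r 0) dotZl enormZ normr0 !mul0r.
have [/enorm_eq0->|y0] := eqVneq (enorm y) 0.
  by rewrite -(scale0r 0) dotZr enormZ normr0 !mul0r mulr0.
have xy : 0 < 2 * (enorm x * enorm y).
  by rewrite !mulr_gt0// lt_neqAle eq_sym enorm_ge0 ?x0 ?y0.
have := dot_ge0 (enorm y *: x - enorm x *: y).
rewrite !dotE (dotC y) -!enorm_sqr => h.
rewrite -subr_ge0 -(pmulr_rge0 _ xy); apply: le_trans h _; rewrite le_eqVlt.
by apply/orP; left; apply/eqP; ring.
Qed.

Lemma ler_enormD x y : enorm (x + y) <= enorm x + enorm y.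
Proof.
rewrite -(@ler_pXn2r _ 2)// ?nnegrE ?addr_ge0 ?enorm_ge0//.
rewrite enorm_sqr !dotE (dotC y) sqrrD -!enorm_sqr.
by have := dot_le_enorm x y; lra.
Qed.

Lemma enorm_le_sum x : enorm x <= \sum_i `|x ord0 i|.
Proof.
have s0 (P : pred 'I_d) : 0 <= \sum_(i | P i) `|x ord0 i| by exact: sumr_ge0.
rewrite -(@ler_pXn2r _ 2)// ?nnegrE ?enorm_ge0//.
rewrite enorm_sqr /dot expr2 mulr_suml ler_sum// => i _.
rewrite (bigD1 i)//= mulrDr -normrM ger0_norm -?expr2 ?sqr_ge0// lerDl.
by rewrite mulr_ge0.
Qed.

Lemma dot_continuous u : continuous (dot u : 'rV[R]_d -> R).
Proof.
move=> x; rewrite /dot; apply: (@cvg_big _ _ _ _ _ add_continuous _ (nbhs x)) => i _.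
by apply: cvgM; [exact: cvg_cst | exact: coord_continuous].
Qed.

Lemma enorm_continuous : continuous (@enorm R d).
Proof.
move=> x; apply: (@continuous_comp _ _ _ (fun y => dot y y) Num.sqrt); last first.
  exact: sqrt_continuous.
rewrite /continuous_at /dot.
apply: (@cvg_big _ _ _ _ _ add_continuous _ (nbhs x)) => i _.
by apply: cvgM; exact: coord_continuous.
Qed.

Lemma enormB_continuous v : continuous (fun u : 'rV[R]_d => enorm (u - v)).
Proof.
move=> u; apply: (@continuous_comp _ _ _ (fun u : 'rV[R]_d => u - v) (@enorm R d)).
  apply: (@cvgB R 'rV[R]_d _ (nbhs u) _ id (cst v)); first exact: cvg_id.
  exact: cvg_cst.
exact: enorm_continuous.
Qed.

Lemma dot_mulmx (Q : 'M[R]_d) x y : Q *m Q^T = 1%:M -> dot (x *m Q) (y *m Q) = dot x y.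
Proof.
have dotM u v : dot u v = (u *m v^T) ord0 ord0.
  by rewrite mxE; apply: eq_bigr => i _; rewrite mxE.
by move=> QQ; rewrite !dotM trmx_mul mulmxA -(mulmxA x) QQ mulmx1.
Qed.

(** The Householder reflection in the hyperplane orthogonal to [u - v]
    exchanges [u] and [v]. *)
Lemma sphere_transitive u v : sphere u -> sphere v ->
  exists2 Q : 'M[R]_d, Q *m Q^T = 1%:M & u *m Q = v.
Proof.
move=> u1 v1.
have [->|uv] := eqVneq u v; first by exists 1%:M; rewrite ?trmx1 ?mulmx1.
pose w := u - v; pose s := dot w w.
have s0 : s != 0.
  rewrite /s -enorm_sqr sqrf_eq0; apply/negP => /eqP/enorm_eq0/eqP.
  by rewrite subr_eq0; apply/negP.
have ww : w *m w^T = s%:M.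
  apply/matrixP => i j; rewrite !ord1 !mxE eqxx mulr1n.
  by apply: eq_bigr => k _; rewrite [X in _ * X]mxE.
pose W := w^T *m w.
have WW : W *m W = s *: W.
  by rewrite mulmxA -(mulmxA w^T) ww mul_mx_scalar -scalemxAl.
exists (1%:M - (2 / s) *: W).
  have -> : (1%:M - (2 / s) *: W)^T = 1%:M - (2 / s) *: W.
    have WT : W^T = W by rewrite trmx_mul trmxK.
    by rewrite -{2}WT; apply/matrixP => i j; rewrite !mxE eq_sym.
  rewrite mulmxBr mulmx1 mulmxBl mul1mx -scalemxAl -scalemxAr WW !scalerA.
  by apply/matrixP => i j; rewrite !mxE; field.
have uw : u *m w^T = (s / 2)%:M.
  apply/matrixP => i j; rewrite !ord1 [RHS]mxE eqxx mulr1n.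
  transitivity (dot u w).
    by rewrite mxE; apply: eq_bigr => k _; rewrite [X in _ * X]mxE.
  by rewrite /s /w !dotE (dotC v) -!enorm_sqr u1 v1; field.
rewrite mulmxBr mulmx1 -scalemxAr mulmxA uw mul_scalar_mx scalerA.
rewrite (_ : 2 / s * (s / 2) = 1); last by field.
by rewrite scale1r /w opprB addrC subrK.
Qed.

End Euclidean.

(** * Support functions of convex bodies *)

Section Support.
Context (R : realType) (d : nat).
Implicit Types (K : set 'rV[R]_d) (u x y z : 'rV[R]_d) (r t e : R).

Lemma convex_body_compact K : convex_body K -> compact K.
Proof. by case. Qed.

Lemma convex_body_nonempty K : convex_body K -> K !=set0.
Proof. by case=> _ _ [a /interior_subset Ka]; exists a. Qed.

Lemma convex_bodyP K x y t : convex_body K -> K x -> K y -> 0 <= t <= 1 ->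
  K ((1 - t) *: x + t *: y).
Proof.
case=> _ cK _ Kx Ky /andP[t0 t1].
have := cK y x (Itv01 t0 t1); rewrite !inE => /(_ Ky Kx).
by rewrite addrC.
Qed.

Lemma convex_body_bounded K : convex_body K ->
  exists2 r, 0 < r & forall x, K x -> enorm x <= r.
Proof.
move=> cK.
have [c _ cM] := @compact_EVT_max _ _ (@enorm R d) _ (convex_body_nonempty cK)
  (convex_body_compact cK) (continuous_subspaceT (@enorm_continuous R d)).
exists (enorm c + 1) => [|x Kx]; first by rewrite ltr_wpDl ?enorm_ge0.
by rewrite (le_trans (cM x _)) ?inE// lerDl.
Qed.

Lemma support_attained K u : convex_body K ->
  exists2 x, K x & support_fun K u = dot u x.
Proof.
move=> cK.
have [c Kc cM] := @compact_EVT_max _ _ (@dot R d u) _ (convex_body_nonempty cK)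
  (convex_body_compact cK) (continuous_subspaceT (@dot_continuous R d u)).
rewrite inE in Kc; exists c => //.
apply/le_anti/andP; split.
  apply: ge_sup; first by exists (dot u c), c.
  by move=> _ [x Kx <-]; apply: cM; rewrite inE.
apply: ub_le_sup; last by exists c.
by exists (dot u c) => _ [x Kx <-]; apply: cM; rewrite inE.
Qed.

Lemma dot_le_support K u x : convex_body K -> K x -> dot u x <= support_fun K u.
Proof.
move=> cK Kx.
have [c _ cM] := @compact_EVT_max _ _ (@dot R d u) _ (convex_body_nonempty cK)
  (convex_body_compact cK) (continuous_subspaceT (@dot_continuous R d u)).
apply: ub_le_sup; last by exists x.
by exists (dot u c) => _ [y Ky <-]; apply: cM; rewrite inE.
Qed.

Lemma support_lipschitz K u v r : convex_body K ->
  (forall x, K x -> enorm x <= r) ->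
  support_fun K u <= support_fun K v + r * enorm (u - v).
Proof.
move=> cK Kr; have [x Kx ->] := support_attained u cK.
rewrite -(subrK v u) dotDl addrC lerD ?dot_le_support// subrK.
by rewrite (le_trans (dot_le_enorm _ _))// mulrC ler_wpM2r ?enorm_ge0 ?Kr.
Qed.

(** [K] contains a ball of centre [a] and radius [r]. Only the consequence on
    support functions is kept: it is the slack that allows shrinking [K]
    towards [a]. *)
Lemma support_interior K : convex_body K ->
  exists2 a, K a & exists2 r, 0 < r &
    forall u, sphere u -> dot u a + r <= support_fun K u.
Proof.
move=> cK; have [_ _ [a Ka]] := cK; exists a; first exact: interior_subset.
have /nbhs_ballP[e /= e0 aeK] : nbhs a K by [].
exists (e / 2) => [|u u1]; first by rewrite divr_gt0.
have uu : dot u u = 1 by rewrite -enorm_sqr u1 expr1n.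
have -> : dot u a + e / 2 = dot u (a + (e / 2) *: u).
  by rewrite dotDr dotZr uu mulr1.
apply: (dot_le_support u cK); apply: aeK; split=> // i j.
rewrite ord1 !mxE /ball /= opprD addNKr normrN normrM.
have := coord_le_enorm u j; rewrite u1 => uj.
rewrite ger0_norm ?divr_ge0 ?ltW// (@le_lt_trans _ _ (e / 2 * 1))//.
  by rewrite ler_wpM2l// divr_ge0// ltW.
by rewrite mulr1; lra.
Qed.

(** The nearest point [y] of [x] in [K], with its variational
    characterisation: [K] lies on one side of the hyperplane through [y]
    orthogonal to [x - y]. *)
Lemma convex_body_projection K x : convex_body K ->
  exists2 y, K y & forall z, K z -> dot (x - y) (z - y) <= 0.
Proof.
move=> cK.
have [y Ky ymin] := @compact_EVT_min _ _ (fun y => enorm (y - x)) _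
  (convex_body_nonempty cK) (convex_body_compact cK)
  (continuous_subspaceT (@enormB_continuous R d x)).
rewrite inE in Ky; exists y => // z Kz; rewrite leNgt; apply/negP.
set p := dot _ _ => p0; set q := dot (z - y) (z - y).
have q0 : 0 <= q by exact: dot_ge0.
(* Moving from y towards z by a small fraction t decreases the squared
   distance to x by 2 t p - t^2 q, which is positive for this t. *)
pose t := p / (p + q + 1).
have s0 : 0 < p + q + 1 by lra.
have t0 : 0 < t by rewrite divr_gt0.
have t1 : t <= 1 by rewrite ler_pdivrMr//; lra.
have /ymin : (1 - t) *: y + t *: z \in K.
  by rewrite inE; apply: convex_bodyP; rewrite ?(ltW t0).
rewrite enormB [leRHS]enormB.
have -> : x - ((1 - t) *: y + t *: z) = (x - y) - t *: (z - y).
  by apply/rowP => i; rewrite !mxE; ring.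
rewrite -(@ler_pXn2r _ 2)// ?nnegrE ?enorm_ge0// !enorm_sqr.
have sqrB (v w : 'rV[R]_d) :
    dot (v - t *: w) (v - t *: w) = dot v v - 2 * t * dot v w + t * (t * dot w w).
  by rewrite !dotE (dotC w v); ring.
rewrite sqrB -/p -/q => h.
have : 2 * p <= t * q by rewrite -(ler_pM2l t0); lra.
rewrite leNgt => /negP; apply.
have : t * q <= p by rewrite /t mulrAC ler_pdivrMr//; nra.
lra.
Qed.

End Support.

(** * Hausdorff distance between a body and a polyhedron with given normals *)

Section HausdorffKhat.
Context (R : realType) (d : nat).
Implicit Types (A B K : set 'rV[R]_d) (X U : nat -> 'rV[R]_d).

Lemma hausdorff_dist_le A B (c : R) :
  (forall x, A x -> exists2 y, B y & enorm (x - y) <= c) ->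
  (forall x, B x -> exists2 y, A y & enorm (x - y) <= c) ->
  (hausdorff_dist A B <= c%:E)%E.
Proof.
move=> AB BA; rewrite /hausdorff_dist ge_max; apply/andP; split;
  apply: ge_ereal_sup => _ [x Ax <-].
- have [y By xy] := AB _ Ax.
  by apply: ereal_inf_le; exists (enorm (x - y))%:E; [exists y | rewrite lee_fin].
- have [y By xy] := BA _ Ax.
  by apply: ereal_inf_le; exists (enorm (x - y))%:E; [exists y | rewrite lee_fin].
Qed.

Lemma hausdorff_dist_ge0 A B : B !=set0 -> (0 <= hausdorff_dist A B)%E.
Proof.
case=> x Bx; rewrite /hausdorff_dist le_max; apply/orP; right.
apply: (@le_trans _ _ (ereal_inf [set (enorm (x - y))%:E | y in A])).
  by apply: le_ereal_inf_tmp => _ [y _ <-]; rewrite lee_fin enorm_ge0.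
by apply: ereal_sup_ubound; exists x.
Qed.

(** If the [U j] form a [delta]-net, then a point [x] of the polyhedron is
    close to its projection [y] on [K]: otherwise some [U j] is close to the
    outer normal [x - y] and its constraint, whose right-hand side is at most
    the support function of [K], would cut [x] off. *)
Lemma khat_near_body K X U n M (rb delta : R) x : convex_body K ->
  (0 < n)%N -> (forall i, (i < n)%N -> K (X i)) ->
  (forall y, K y -> enorm y <= rb) -> 0 <= delta <= 1 / 2 ->
  (forall u, sphere u -> exists2 j, (j < M)%N & enorm (u - U j) <= delta) ->
  khat n M X U x -> exists2 y, K y & enorm (x - y) <= 4 * rb * delta.
Proof.
move=> cK n0 XK Krb /andP[delta0 delta2] net hx.
have [y Ky py] := convex_body_projection x cK; exists y => //.
have rb0 : 0 <= rb := le_trans (enorm_ge0 y) (Krb y Ky).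
have [->|xy0] := eqVneq (enorm (x - y)) 0; first by rewrite !mulr_ge0.
set t := enorm (x - y) in xy0 *.
have t0 : 0 < t by rewrite lt_neqAle eq_sym xy0 enorm_ge0.
pose u := t^-1 *: (x - y).
have u1 : sphere u by rewrite /sphere /= enormZ ger0_norm ?invr_ge0 ?ltW// mulVf.
have hu : support_fun K u <= dot u y.
  have [z Kz ->] := support_attained u cK.
  rewrite -subr_ge0 -oppr_le0 opprB -dotNr -dotDr /u dotZl.
  by rewrite pmulr_rle0 ?invr_gt0// py.
have [j jM uUj] := net _ u1.
have Ujx : dot (U j) x <= dot u y + rb * delta.
  apply: le_trans (hx j jM) _; apply: (@le_trans _ _ (support_fun K (U j))).
    by apply: bigmax_le => [|i _]; apply: dot_le_support => //; apply: XK.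
  apply: le_trans (support_lipschitz _ u cK Krb) _.
  by rewrite lerD// ler_wpM2l// enormB.
have Ujy : dot (u - U j) y <= delta * rb.
  by apply: le_trans (dot_le_enorm _ _) _; rewrite ler_pM ?enorm_ge0 ?Krb.
have Uju : dot (u - U j) u <= delta.
  by apply: le_trans (dot_le_enorm _ _) _; rewrite u1 mulr1.
have uu : dot u u = 1 by rewrite -enorm_sqr u1 expr1n.
have xE : x = y + t *: u by rewrite /u scalerA mulfV// scale1r addrC subrK.
move: Ujx Ujy Uju; rewrite {1}xE dotDr dotZr !dotDl !dotNl uu => h1 h2 h3.
have h4 : 1 / 2 <= dot (U j) u by lra.
have := ler_wpM2l (ltW t0) h4; lra.
Qed.

(** Conversely, moving a point of [K] towards the centre of a ball of radius
    [r] inside [K], by the fraction [e / r], leaves it at depth at least [e]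
    below every supporting hyperplane of [K], hence in the polyhedron. *)
Lemma body_near_khat K X U n M a (r rb e : R) x : convex_body K ->
  K a -> (forall u, sphere u -> dot u a + r <= support_fun K u) -> 0 < r ->
  (forall y, K y -> enorm y <= rb) -> 0 <= e <= r ->
  (forall j, (j < M)%N -> sphere (U j)) ->
  (forall j, (j < M)%N -> exists2 i, (i < n)%N &
     support_fun K (U j) - e <= dot (U j) (X i)) ->
  K x -> exists2 y, khat n M X U y & enorm (x - y) <= 2 * rb * e / r.
Proof.
move=> cK Ka har r0 Krb /andP[e0 er] U1 hits Kx.
pose t := e / r.
have t0 : 0 <= t by rewrite divr_ge0 ?(ltW r0).
have t1 : t <= 1 by rewrite ler_pdivrMr// mul1r.
have tr : t * r = e by rewrite /t mulfVK ?gt_eqF.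
exists ((1 - t) *: x + t *: a).
  move=> j jM; have [i iN hi] := hits j jM.
  apply: le_trans (le_trans _ hi) _; last first.
    exact: (@bigmax_sup _ _ _ _ (Ordinal iN)).
  rewrite dotDr !dotZr.
  have h1 : dot (U j) x <= support_fun K (U j) by exact: dot_le_support.
  have h2 := har _ (U1 j jM).
  have s0 : 0 <= 1 - t by lra.
  have := ler_wpM2l s0 h1; have := ler_wpM2l t0 h2; lra.
have -> : x - ((1 - t) *: x + t *: a) = t *: (x - a).
  by apply/rowP => i; rewrite !mxE; ring.
rewrite enormZ ger0_norm// (_ : 2 * rb * e / r = t * (2 * rb)); last first.
  by rewrite /t; ring.
rewrite ler_wpM2l// (le_trans (ler_enormD _ _))// enormN mulr_natl mulr2n.
by rewrite lerD ?Krb.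
Qed.

End HausdorffKhat.

(** * Finite nets of the sphere *)

Section SphereNet.
Context (R : realType).

Definition grid_point (m i : nat) : R := (2 * i%:R + 1) / m%:R - 1.

Lemma grid_approx (m : nat) (t : R) : (0 < m)%N -> `|t| <= 1 ->
  exists i : 'I_m, `|t - grid_point m i| <= m%:R^-1.
Proof.
move=> m0; rewrite ler_norml => /andP[t0 t1].
have m0R : (0 : R) < m%:R by rewrite ltr0n.
pose s := m%:R * (t + 1) / 2; pose i := minn (Num.truncn s) m.-1.
have im : (i < m)%N by rewrite /i gtn_min prednK// leqnn orbT.
have s0 : 0 <= s by rewrite divr_ge0// mulr_ge0 ?(ltW m0R)//; lra.
have [h1 h2] : i%:R <= s /\ s <= i%:R + 1.
  have /andP[a b] := truncn_itv s0; rewrite /i; case: leqP => h.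
    by split=> //; rewrite -natr1 in b; exact: ltW.
  split; first by rewrite (le_trans _ a)// ler_nat ltnW.
  by rewrite natr1 prednK// /s ler_pdivrMr// ler_pM2l//; lra.
exists (Ordinal im) => /=.
have ts : t = 2 * s / m%:R - 1 by rewrite /s; field; rewrite gt_eqF.
rewrite ts /grid_point (_ : _ - _ = (2 * s - (2 * i%:R + 1)) / m%:R); last by ring.
rewrite normrM normfV (ger0_norm (ltW m0R)) -[leRHS]mul1r.
by rewrite ler_pM2r ?invr_gt0// ler_norml; lra.
Qed.

(** Leaving out of the grid one coordinate [k] of large size, which the other
    coordinates and its sign [s] determine, is what makes the number of cells
    of order [m ^ D] instead of [m ^ (D + 1)]. *)
Definition sphere_cell (D m : nat) (c : 'I_D.+1 * bool * {ffun 'I_D -> 'I_m}) :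
    set 'rV[R]_D.+1 :=
  [set u | let: (k, s, f) := c in
    [/\ sphere u, 1 <= D.+1%:R * `|u ord0 k|, (0 <= u ord0 k) = s &
     forall j, `|u ord0 (lift k j) - grid_point m (f j)| <= m%:R^-1]].

(** The coordinates of a unit vector have absolute values of sum at least 1, so
    that the largest is at least [1 / (D + 1)]. *)
Lemma sphere_cell_cover (D m : nat) (u : 'rV[R]_D.+1) : (0 < m)%N ->
  sphere u -> exists c, sphere_cell (m := m) c u.
Proof.
move=> m0 u1.
have [k uk] : exists k, 1 <= D.+1%:R * `|u ord0 k|.
  apply/not_existsP => small.
  have : \sum_(i < D.+1) D.+1%:R * `|u ord0 i| < \sum_(i < D.+1) 1.
    apply: ltr_sum => [|i _]; last by rewrite ltNge; apply/negP/small.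
    by apply/hasP; exists ord0 => //; rewrite mem_index_enum.
  rewrite -mulr_sumr sumr_const card_ord ltNge -[leLHS]mulr1 ler_pM2l ?ltr0n//.
  by rewrite -[X in X <= _]u1 enorm_le_sum.
have grid j : exists i : 'I_m, `|u ord0 (lift k j) - grid_point m i| <= m%:R^-1.
  by apply: grid_approx => //; rewrite -[leRHS]u1 coord_le_enorm.
exists (k, 0 <= u ord0 k, [ffun j => sval (cid (grid j))]); split=> // j.
by rewrite ffunE; case: cid.
Qed.

(** The coordinate [k] is recovered up to sign from the equation of the sphere,
    with a Lipschitz constant controlled by its lower bound. *)
Lemma sphere_cell_diam (D m : nat) c (u v : 'rV[R]_D.+1) :
  sphere_cell (m := m) c u -> sphere_cell c v ->
  enorm (u - v) <= 2 * D.+1%:R ^+ 2 / m%:R.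
Proof.
case: c => [[k s] f] [u1 uk us uf] [v1 vk vs vf].
apply: le_trans (enorm_le_sum _) _.
pose S := \sum_(j < D) `|u ord0 (lift k j) - v ord0 (lift k j)|.
have Sle : S <= D%:R * (2 / m%:R).
  rewrite /S mulr_natl -[D in leRHS]card_ord -sumr_const; apply: ler_sum => j _.
  apply: le_trans (ler_distD (grid_point m (f j)) _ _) _.
  by rewrite (distrC (grid_point _ _)) mulr_natl mulr2n lerD.
have uv1 (w : 'rV[R]_D.+1) i : sphere w -> `|w ord0 i| <= 1.
  by move=> w1; rewrite -w1 coord_le_enorm.
have sqr1 (w : 'rV[R]_D.+1) : sphere w ->
    w ord0 k ^+ 2 + \sum_(j < D) w ord0 (lift k j) ^+ 2 = 1.
  move=> w1; transitivity (dot w w); last by rewrite -enorm_sqr w1 expr1n.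
  by rewrite /dot [RHS](bigD1_ord k).
have kS : `|u ord0 k - v ord0 k| * `|u ord0 k + v ord0 k| <= 2 * S.
  rewrite -normrM -subr_sqr.
  have -> : u ord0 k ^+ 2 - v ord0 k ^+ 2 =
      \sum_(j < D) (v ord0 (lift k j) ^+ 2 - u ord0 (lift k j) ^+ 2).
    by rewrite sumrB; have := sqr1 _ u1; have := sqr1 _ v1; lra.
  apply: le_trans (ler_norm_sum _ _ _) _; rewrite mulr_sumr ler_sum// => j _.
  rewrite subr_sqr normrM mulrC distrC ler_wpM2r//.
  by rewrite (le_trans (ler_normD _ _))// mulr2n lerD ?uv1.
have uvk : 2 <= D.+1%:R * `|u ord0 k + v ord0 k|.
  have -> : `|u ord0 k + v ord0 k| = `|u ord0 k| + `|v ord0 k|.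
    have [uk0|uk0] := leP 0 (u ord0 k).
      by rewrite !ger0_norm ?addr_ge0// vs -us.
    have vk0 : v ord0 k < 0 by rewrite ltNge vs -us -ltNge.
    have uv0 : u ord0 k + v ord0 k < 0 by lra.
    by rewrite !ltr0_norm// opprD.
  by rewrite mulrDr mulr2n lerD.
have kS' : `|u ord0 k - v ord0 k| <= D.+1%:R * S.
  have h1 := ler_wpM2l (normr_ge0 (u ord0 k - v ord0 k)) uvk.
  have h2 := ler_wpM2l (ler0n R D.+1) kS.
  lra.
rewrite (bigD1_ord k)//= !mxE.
under eq_bigr do rewrite !mxE.
rewrite -/S; apply: (@le_trans _ _ ((D.+1%:R + 1) * S)).
  by rewrite mulrDl mul1r lerD.
apply: (@le_trans _ _ ((D.+1%:R + 1) * (D%:R * (2 / m%:R)))).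
  by rewrite ler_wpM2l// addr_ge0.
rewrite mulrA [leRHS]mulrAC [leRHS]mulrC ler_wpM2r ?divr_ge0//.
by rewrite -natr1; lra.
Qed.

Lemma sphere_net (D m : nat) : (0 < m)%N ->
  exists (I : finType) (v : I -> 'rV[R]_D.+1),
    [/\ #|I| = (2 * D.+1 * m ^ D)%N, forall c, sphere (v c) &
      forall u, sphere u ->
        exists c, enorm (u - v c) <= 2 * D.+1%:R ^+ 2 / m%:R].
Proof.
move=> m0; have [e e1] : exists e : 'rV[R]_D.+1, sphere e.
  exists (delta_mx ord0 ord0); rewrite /sphere /= /enorm /dot big_ord_recl big1.
    by rewrite !mxE !eqxx mulr1 addr0 sqrtr1.
  by move=> i _; rewrite !mxE mulr0.
exists ('I_D.+1 * bool * {ffun 'I_D -> 'I_m})%type, (fun c => xget e (sphere_cell c)).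
split.
- by rewrite !card_prod card_bool card_ffun !card_ord (mulnC 2%N).
- by move=> c; case: xgetP => [w _|//]; case: c => [[k s] f] [].
- move=> u u1; have [c uc] := sphere_cell_cover m0 u1; exists c.
  by apply: (sphere_cell_diam uc); apply: xgetPex; exists u.
Qed.

End SphereNet.

(** * Measurability of the events, and the union bound *)

Section Measurability.
Context (R : realType) (d : nat).

Lemma closed_borel (A : set 'rV[R]_d) : closed A ->
  measurable (A : set (borel_vec R d)).
Proof.
move=> cA; rewrite -(setCK A); apply: measurableC.
by apply: sub_sigma_algebra; exact: closed_openC.
Qed.

Lemma measurable_ball_enorm (v : 'rV[R]_d) (r : R) :
  measurable ([set u | enorm (u - v) <= r] : set (borel_vec R d)).
Proof.
apply: closed_borel.
apply: (@preimage_closed _ _ _ [set x | x <= r]) (@closed_le R r).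
exact: in1W (@enormB_continuous R d v).
Qed.

Lemma measurable_sphere : measurable (@sphere R d : set (borel_vec R d)).
Proof.
apply: closed_borel.
have -> : @sphere R d = @enorm R d @^-1` [set x | x = 1] by [].
apply: preimage_closed; first exact: in1W (@enorm_continuous R d).
exact: closed_eq.
Qed.

Lemma measurable_cap (K : set 'rV[R]_d) u e : convex_body K ->
  measurable (cap K u e : set (borel_vec R d)).
Proof.
move=> cK; apply: closed_borel; apply: closedI.
  exact: compact_closed (@norm_hausdorff _ _) (convex_body_compact cK).
apply: (@preimage_closed _ _ _ [set x | _ <= x]) (@closed_ge R _).
exact: in1W (@dot_continuous R d u).
Qed.

Lemma measurable_convex_body (K : set 'rV[R]_d) : convex_body K ->
  measurable (K : set (borel_vec R d)).
Proof.
move=> cK; apply: closed_borel.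
exact: compact_closed (@norm_hausdorff _ _) (convex_body_compact cK).
Qed.

Lemma measure_bigsetU_le (dT : measure_display) (T : measurableType dT)
  (P : {measure set T -> \bar R}) (I : Type) (s : seq I) (A : I -> set T) (c : R) :
  (forall i, measurable (A i)) -> (forall i, (P (A i) <= c%:E)%E) ->
  (P (\big[setU/set0]_(i <- s) A i) <= ((size s)%:R * c)%:E)%E.
Proof.
move=> mA Ac; elim: s => [|i s IH]; first by rewrite big_nil measure0 mul0r.
rewrite big_cons /= -natr1 addrC mulrDl mul1r EFinD.
have mU : measurable (\big[setU/set0]_(i <- s) A i) by exact: bigsetU_measurable.
by apply: le_trans (measureU2 _ (mA i) mU) _; apply: (leeD (Ac i) IH).
Qed.

End Measurability.

(** * The uniform distribution on the sphere *)

Section UniformSphere.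
Context (R : realType) (d : nat).

(** Balls centred on the sphere all have the same mass, by invariance, and
    finitely many of them cover the sphere. *)
Lemma uniform_sphere_ball (sigma : probability (borel_vec R d) R) (I : finType)
    (v : I -> 'rV[R]_d) (r : R) (u : 'rV[R]_d) :
  uniform_sphere sigma -> (forall c, sphere (v c)) ->
  (forall w, sphere w -> exists c, enorm (w - v c) <= r) -> sphere u ->
  ((#|I|%:R^-1)%:E <= sigma [set w | (enorm (w - u) <= r)%R])%E.
Proof.
move=> [sigma1 inv] v1 net u1.
set b := sigma _.
have bE c : sigma [set w | (enorm (w - v c) <= r)%R] = b.
  have [Q QQ vQ] := sphere_transitive (v1 c) u1.
  rewrite /b -(inv Q _ QQ (measurable_ball_enorm u r)); congr (sigma _).
  by apply/seteqP; split=> w /=; rewrite -vQ -mulmxBl /enorm dot_mulmx.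
have bfin : b \is a fin_num by exact: fin_num_measure (measurable_ball_enorm u r).
have [c0 _] := net u u1.
have I0 : (0 < #|I|)%N by apply/card_gt0P; exists c0.
have : (1 <= (#|I|%:R * fine b)%:E :> \bar R)%E.
  rewrite -sigma1; apply: (@le_trans _ _
    (sigma (\big[setU/set0]_(c <- enum I) [set w | (enorm (w - v c) <= r)%R]))).
    apply: le_measure; rewrite ?inE.
    - exact: measurable_sphere.
    - by apply: bigsetU_measurable => c _; exact: measurable_ball_enorm.
    - move=> w w1; have [c wc] := net w w1.
      by rewrite -bigcup_seq; exists c => //=; rewrite mem_enum.
  rewrite cardE; apply: measure_bigsetU_le => c; first exact: measurable_ball_enorm.
  by rewrite (fineK bfin) -(bE c).
rewrite lee_fin => h; rewrite -(fineK bfin) lee_fin.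
by rewrite -[leLHS]mul1r ler_pdivrMr ?ltr0n// mulrC.
Qed.

End UniformSphere.

(** * Independent samples hit sets of given mass *)

Section Hitting.
Context (R : realType) (d : nat) (dT : measure_display) (T : measurableType dT)
  (P : probability T R).

Lemma has_lawP (X : {mfun T >-> borel_vec R d}) mu A :
  has_law P X mu -> measurable A -> P (X @^-1` A) = mu A.
Proof. by move=> law mA; rewrite -law. Qed.

Lemma measurable_hit (X : {mfun T >-> borel_vec R d}) (A : set (borel_vec R d)) :
  measurable A -> measurable (X @^-1` A).
Proof. by move=> mA; rewrite -[_ @^-1` _]setTI; exact: measurable_funP. Qed.

(** By independence the probability is [(1 - mu A) ^ M], and
    [1 - q <= exp (- q)]. *)
Lemma iid_all_miss (D : set nat) (X : nat -> {mfun T >-> borel_vec R d}) mu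
    (A : set (borel_vec R d)) (M : nat) (q : R) :
  iid P D X mu -> `I_M `<=` D -> measurable A -> 0 <= q ->
  (q%:E <= mu A)%E ->
  (P (\bigcap_(i in `I_M) (X i @^-1` (~` A))) <= (expR (- (M%:R * q)))%:E)%E.
Proof.
move=> [law indep] MD mA q0 qA.
pose J : {fset nat} := seq_fset tt (iota 0 M).
have JM : [set` J] = `I_M.
  by apply/seteqP; split=> i /=; rewrite seq_fsetE mem_iota.
rewrite -JM indep ?JM//; last by move=> i; exact: measurableC.
have Afin : mu A \is a fin_num by exact: fin_num_measure.
rewrite (perm_big _ (seq_fset_perm tt _)) (undup_id (iota_uniq 0 M)) /=.
rewrite big_seq (eq_bigr (fun=> (1 - fine (mu A))%:E)); last first.
  move=> i; rewrite mem_iota => /andP[_ iM].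
  rewrite (has_lawP (law _ (MD _ iM)))//; last exact: measurableC.
  by rewrite probability_setC// EFinB fineK.
rewrite -big_seq prodEFin lee_fin -{1}[M]subn0 -/(index_iota 0 M) prodr_const_nat subn0.
rewrite -mulrN expRM_natl.
have q1 : q <= fine (mu A) by rewrite -lee_fin fineK.
have A1 : fine (mu A) <= 1 by rewrite -lee_fin fineK// probability_le1.
apply: lerXn2r; rewrite ?nnegrE ?expR_ge0 ?subr_ge0//.
by have := expR_ge1Dx (- q); lra.
Qed.

End Hitting.

(** * The approximation error for a given sample size *)

Section GoodSample.
Context (R : realType) (d : nat).

(** The configurations for which the approximation error is controlled; [v]
    stands for a fixed net of the sphere. *)
Definition good_sample (K : set 'rV[R]_d) (I : finType) (v : I -> 'rV[R]_d)
    (delta e : R) (n M : nat) (X U : nat -> 'rV[R]_d) : Prop :=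
  [/\ forall j, (j < M)%N -> sphere (U j),
      forall i, (i < n)%N -> K (X i),
      forall c, exists2 j, (j < M)%N & enorm (U j - v c) <= delta &
      forall c, exists2 i, (i < n)%N & cap K (v c) e (X i)].

(** The directions form a [2 delta]-net. In passing from the cap of a net point
    [v c] to the direction [U j], the support function and the linear form at
    the sample point each lose [rb * delta], since both are [rb]-Lipschitz in
    the direction. *)
Lemma good_sample_hausdorff (K : set 'rV[R]_d) (I : finType) (v : I -> 'rV[R]_d)
    (delta e : R) (n M : nat) (X U : nat -> 'rV[R]_d) a r rb : convex_body K ->
  K a -> (forall u, sphere u -> dot u a + r <= support_fun K u) -> 0 < r ->
  (forall y, K y -> enorm y <= rb) ->
  (forall u, sphere u -> exists c, enorm (u - v c) <= delta) ->
  0 <= delta <= 1 / 4 -> 0 <= e -> e + 2 * rb * delta <= r -> (0 < n)%N ->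
  good_sample K v delta e n M X U ->
  (hausdorff_dist (khat n M X U) K <=
   (8 * rb * delta + 2 * rb * (e + 2 * rb * delta) / r)%:E)%E.
Proof.
move=> cK Ka har r0 Krb net /andP[delta0 delta4] e0 er n0 [U1 XK hitU hitX].
have rb0 : 0 <= rb := le_trans (enorm_ge0 a) (Krb a Ka).
have netU u : sphere u -> exists2 j, (j < M)%N & enorm (u - U j) <= 2 * delta.
  move=> u1; have [c uc] := net u u1; have [j jM jc] := hitU c; exists j => //.
  rewrite -(subrK (v c) u) -addrA (le_trans (ler_enormD _ _))//.
  by rewrite mulr_natl mulr2n lerD// enormB.
have hits j : (j < M)%N -> exists2 i, (i < n)%N &
    support_fun K (U j) - (e + 2 * rb * delta) <= dot (U j) (X i).
  move=> jM; have [c uc] := net _ (U1 j jM); have [i iN [Xi hi]] := hitX c.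
  exists i => //.
  have h1 := support_lipschitz (U j) (v c) cK Krb.
  have h2 : dot (v c - U j) (X i) <= delta * rb.
    rewrite (le_trans (dot_le_enorm _ _))// ler_pM ?enorm_ge0 ?Krb//.
    by rewrite enormB.
  have h3 := ler_wpM2l rb0 uc.
  move: h2; rewrite dotDl dotNl; lra.
have b0 : 0 <= 2 * rb * (e + 2 * rb * delta) / r.
  by rewrite divr_ge0 ?(ltW r0)// !mulr_ge0 ?addr_ge0 ?mulr_ge0.
apply: hausdorff_dist_le => x hx.
  have [|y Ky xy] :=
    @khat_near_body _ _ K X U n M rb (2 * delta) x cK n0 XK Krb _ netU hx.
    by apply/andP; split; lra.
  by exists y => //; lra.
have [|y Ky xy] := @body_near_khat _ _ K X U n M a r rb (e + 2 * rb * delta) x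
   cK Ka har r0 Krb _ U1 hits hx.
  by rewrite er andbT addr_ge0// !mulr_ge0.
by exists y => //; rewrite (le_trans xy)// lerDr !mulr_ge0.
Qed.

(** A union bound: the directions leave the sphere and the points leave [K] with
    probability 0, and each net point fails for the directions or for the
    sample with the probability given by [iid_all_miss]. *)
Lemma good_sample_probability (dT : measure_display) (T : measurableType dT)
    (P : probability T R) (K : set 'rV[R]_d) (I : finType) (v : I -> 'rV[R]_d)
    (delta e q : R) (n M : nat) (X U : nat -> {mfun T >-> borel_vec R d})
    (mu sigma : probability (borel_vec R d) R) : convex_body K ->
  iid P setT X mu -> mu K = 1%E ->
  iid P `I_M U sigma -> uniform_sphere sigma ->
  (forall c, sphere (v c)) ->
  (forall u, sphere u -> exists c, enorm (u - v c) <= delta) ->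
  0 <= q -> (forall c, (q%:E <= mu (cap K (v c) e))%E) ->
  exists E, [/\ measurable E,
    (P E <= (#|I|%:R * expR (- (M%:R * #|I|%:R^-1)) +
             #|I|%:R * expR (- (n%:R * q)))%:E)%E &
    forall w, ~ E w ->
      good_sample K v delta e n M (fun i => X i w) (fun j => U j w)].
Proof.
move=> cK iX muK iU unif v1 net q0 capq.
have mS := @measurable_sphere R d.
have mK := measurable_convex_body cK.
have mB c := measurable_ball_enorm (v c) delta.
have mC c := measurable_cap (v c) e cK.
pose ES j := U j @^-1` (~` @sphere R d).
pose EK i := X i @^-1` (~` K).
pose EU c := \bigcap_(j in `I_M) (U j @^-1` (~` [set w | enorm (w - v c) <= delta])).
pose EX c := \bigcap_(i in `I_n) (X i @^-1` (~` cap K (v c) e)).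
have mES j : measurable (ES j).
  by apply: measurable_hit; exact: measurableC.
have mEK i : measurable (EK i).
  by apply: measurable_hit; exact: measurableC.
have mEU c : measurable (EU c).
  by apply: bigcap_measurableType => j _; apply: measurable_hit; exact: measurableC.
have mEX c : measurable (EX c).
  by apply: bigcap_measurableType => i _; apply: measurable_hit; exact: measurableC.
have PES (j : 'I_M) : (P (ES j) <= 0%:E)%E.
  rewrite (has_lawP (iU.1 j (ltn_ord j))); last exact: measurableC.
  by rewrite probability_setC ?unif.1 ?subee.
have PEK (i : 'I_n) : (P (EK i) <= 0%:E)%E.
  rewrite (has_lawP (iX.1 i Logic.I)); last exact: measurableC.
  by rewrite probability_setC ?muK ?subee.
have PEU c : (P (EU c) <= (expR (- (M%:R * #|I|%:R^-1)))%:E)%E.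
  apply: (iid_all_miss iU) => //; exact: (uniform_sphere_ball unif v1 net).
have PEX c : (P (EX c) <= (expR (- (n%:R * q)))%:E)%E by exact: (iid_all_miss iX).
pose ES' := \big[setU/set0]_(j <- enum 'I_M) ES j.
pose EK' := \big[setU/set0]_(i <- enum 'I_n) EK i.
pose EU' := \big[setU/set0]_(c <- enum I) EU c.
pose EX' := \big[setU/set0]_(c <- enum I) EX c.
have mES' : measurable ES' by exact: bigsetU_measurable.
have mEK' : measurable EK' by exact: bigsetU_measurable.
have mEU' : measurable EU' by exact: bigsetU_measurable.
have mEX' : measurable EX' by exact: bigsetU_measurable.
exists ((ES' `|` EK') `|` (EU' `|` EX')); split.
- by apply: measurableU; exact: measurableU.
- apply: le_trans (measureU2 _ (measurableU _ _ mES' mEK') (measurableU _ _ mEU' mEX')) _.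
  rewrite -[leRHS]add0e; apply: leeD.
    apply: le_trans (measureU2 _ mES' mEK') _; rewrite -[leRHS]add0e; apply: leeD.
      by apply: le_trans (measure_bigsetU_le _ _ PES) _ => //; rewrite mulr0.
    by apply: le_trans (measure_bigsetU_le _ _ PEK) _ => //; rewrite mulr0.
  apply: le_trans (measureU2 _ mEU' mEX') _; rewrite EFinD.
  by apply: leeD; rewrite {1}cardE; apply: measure_bigsetU_le.
- move=> w /not_orP[/not_orP[nES nEK] /not_orP[nEU nEX]].
  rewrite /ES' /EK' /EU' /EX' -!bigcup_seq in nES nEK nEU nEX.
  split.
  + move=> j jM; apply: contrapT => nS; apply: nES.
    by exists (Ordinal jM) => //=; rewrite mem_enum.
  + move=> i iN; apply: contrapT => nS; apply: nEK.
    by exists (Ordinal iN) => //=; rewrite mem_enum.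
  + move=> c; apply: contrapT => nS; apply: nEU; exists c; rewrite /= ?mem_enum//.
    by move=> j /= jM hj; apply: nS; exists j.
  + move=> c; apply: contrapT => nS; apply: nEX; exists c; rewrite /= ?mem_enum//.
    by move=> j /= jM hj; apply: nS; exists j.
Qed.

End GoodSample.

(** * Asymptotics of the rate *)

Section Rate.
Context (R : realType).
Implicit Types (alpha C c : R) (n D : nat).

Definition rate alpha n : R := (ln n%:R / n%:R) `^ alpha^-1.

Lemma ln_nat_ge1 : \forall n \near \oo, 1 <= ln n%:R :> R.
Proof.
exists (Num.truncn (expR 1 : R)).+1 => // n /= hn.
have n0 : (0 : R) < n%:R by rewrite ltr0n (leq_trans _ hn).
rewrite -[leLHS](expRK 1) ler_ln ?posrE ?expR_gt0//.
by apply: (le_trans (ltW (truncnS_gt _))); rewrite ler_nat.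
Qed.

Lemma ln_le_sqrt (x : R) : 0 < x -> ln x <= 2 * Num.sqrt x.
Proof.
move=> x0; have s0 : 0 < Num.sqrt x by rewrite sqrtr_gt0.
rewrite -{1}(sqr_sqrtr (ltW x0)) lnXn// mulr2n mulr_natl mulr2n.
by rewrite lerD// ltW// ln_sublinear.
Qed.

(** [ln n / n <= 2 / sqrt n], by [ln_le_sqrt]. *)
Lemma rate_small alpha c : 0 < alpha -> 0 < c ->
  \forall n \near \oo, rate alpha n <= c.
Proof.
move=> a0 c0; pose k := c `^ alpha.
have k0 : 0 < k by rewrite powR_gt0.
exists (Num.truncn ((2 / k) ^+ 2)).+1 => // n /= hn.
have n0 : (0 : R) < n%:R by rewrite ltr0n (leq_trans _ hn).
have s0 : 0 < Num.sqrt (n%:R : R) by rewrite sqrtr_gt0.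
have nk : 2 / k <= Num.sqrt n%:R.
  rewrite -[leLHS]ger0_norm ?divr_ge0 ?(ltW k0)// -sqrtr_sqr ler_sqrt ?(ltW n0)//.
  by apply: (le_trans (ltW (truncnS_gt _))); rewrite ler_nat.
have lnk : ln n%:R / n%:R <= k.
  rewrite ler_pdivrMr// (le_trans (ln_le_sqrt n0))//.
  rewrite -{2}(sqr_sqrtr (ltW n0)) expr2 mulrA ler_pM2r//.
  by rewrite mulrC -ler_pdivrMr.
have -> : c = k `^ alpha^-1 by rewrite /k -powRrM mulfV ?gt_eqF// powRr1// ltW.
have ln0 : 0 <= ln (n%:R : R) by rewrite ln_ge0// ler1n (leq_trans _ hn).
by rewrite ge0_ler_powR ?nnegrE ?invr_ge0 ?divr_ge0// ltW.
Qed.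

Lemma rate_gt0 alpha n : 1 <= ln (n%:R : R) -> 0 < rate alpha n.
Proof.
move=> l1; have n0 : (0 : R) < n%:R.
  by rewrite ltr0n lt0n; apply: contraTneq l1 => ->; rewrite ln0// -ltNge.
by rewrite powR_gt0// divr_gt0// (lt_le_trans _ l1).
Qed.

Lemma rate_expR alpha n : 1 <= ln (n%:R : R) ->
  rate alpha n = expR (alpha^-1 * (ln (ln n%:R) - ln n%:R)).
Proof.
move=> l1; have n0 : (0 : R) < n%:R.
  by rewrite ltr0n lt0n; apply: contraTneq l1 => ->; rewrite ln0// -ltNge.
have l0 : 0 < ln (n%:R : R) by exact: lt_le_trans l1.
by rewrite /rate /powR gt_eqF ?divr_gt0// ln_div ?posrE.
Qed.

(** A union bound over a net of the sphere of [O(rate ^- D)] points, each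
    failing with probability at most [n ^ (- (D + 1) / alpha)]; since the rate
    is at least [n ^ (- 1 / alpha)], one factor of the rate is left. *)
Lemma net_union_bound alpha n D (N t : R) : 0 < alpha ->
  1 <= ln (n%:R : R) -> 0 <= N ->
  N <= 2 * D.+1%:R * (rate alpha n)^-1 ^+ D ->
  D.+1%:R / alpha * ln n%:R <= t ->
  N * expR (- t) <= 2 * D.+1%:R * rate alpha n.
Proof.
move=> a0 l1 N0 NN tt.
set rho := rate alpha n in NN *.
have rho0 : 0 < rho := rate_gt0 alpha l1.
pose s := expR (- (alpha^-1 * ln (n%:R : R))).
have s0 : 0 < s by exact: expR_gt0.
have srho : s <= rho.
  rewrite /rho rate_expR// ler_expR mulrBr lerBrDr addNr.
  by rewrite mulr_ge0 ?invr_ge0 ?(ltW a0)// ln_ge0.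
have ts : expR (- t) <= s ^+ D.+1.
  rewrite -expRM_natl ler_expR mulrN lerN2 (le_trans _ tt)//.
  by rewrite mulrA.
apply: (@le_trans _ _ (2 * D.+1%:R * s^-1 ^+ D * s ^+ D.+1)).
  apply: ler_pM; rewrite ?expR_ge0// (le_trans NN)// ler_wpM2l ?mulr_ge0//.
  by apply: lerXn2r; rewrite ?nnegrE ?invr_ge0 ?(ltW rho0) ?(ltW s0)// lef_pV2.
rewrite exprSr mulrA -(mulrA _ (s^-1 ^+ D)) -exprMn mulVf ?gt_eqF// expr1n mulr1.
by rewrite ler_wpM2l ?mulr_ge0.
Qed.

(** The exponents in the number of directions are such that it is at least of
    order [ln n] times the number of balls of radius [rate] that cover the
    sphere. *)
Lemma num_dir_ge alpha C n D : 0 < alpha -> 0 <= C -> 1 <= ln (n%:R : R) ->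
  C * ln n%:R * (rate alpha n)^-1 ^+ D <= (num_dir D.+1 alpha C n)%:R.
Proof.
move=> a0 C0 l1; have l0 : 0 < ln (n%:R : R) by exact: lt_le_trans l1.
have n0 : (0 : R) < n%:R.
  by rewrite ltr0n lt0n; apply: contraTneq l1 => ->; rewrite ln0// -ltNge.
set y := C * _ * _.
suff -> : y = C * (n%:R `^ ((D.+1%:R - 1) / alpha))
                * (ln n%:R `^ ((alpha - D.+1%:R + 1) / alpha)).
  rewrite /num_dir; set z := _ * _ * _.
  rewrite (le_trans (ceil_ge z))// natr_absz ler_int ler_norm.
  by [].
rewrite /y rate_expR// -!mulrA; congr (_ * _).
rewrite /powR !gt_eqF// -expRN -expRM_natl -{1}(lnK l0) -!expRD; congr expR.
by rewrite -natr1; field; rewrite gt_eqF.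
Qed.

End Rate.

Unset Implicit Arguments.

Theorem theorem9 (R : realType) (d : nat) (hd : (0 < d)%N)
  (K : set 'rV[R]_d) (hK : convex_body K)
  (dT : measure_display) (T : measurableType dT) (P : probability T R)
  (mu : probability (borel_vec R d) R) (hmuK : mu K = 1%E)
  (X : nat -> {mfun T >-> borel_vec R d}) (hX : iid P setT X mu)
  (alpha L eps0 : R) (halpha : 0 < alpha) (hL : 0 < L)
  (heps0 : 0 < eps0) (heps01 : eps0 <= 1)
  (hcap : forall (u : 'rV[R]_d) (e : R), sphere u -> 0 <= e <= eps0 ->
    ((L * e `^ alpha)%:E <= mu (cap K u e))%E)
  (C : R)
  (hC : 2 * alpha^-1 * d%:R ^+ 2 * 8 `^ ((d%:R - 1) / 2) < C)
  (sigma : probability (borel_vec R d) R) (hsigma : uniform_sphere sigma)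
  (U : nat -> nat -> {mfun T >-> borel_vec R d})
  (hU : forall n, (2 <= n)%N -> iid P `I_(num_dir d alpha C n) (U n) sigma)
  (hXU : forall n, (2 <= n)%N ->
    independent_families P `I_n `I_(num_dir d alpha C n) X (U n)) :
  bigO_P P
    (fun n w => hausdorff_dist
       (khat n (num_dir d alpha C n) (fun i => X i w) (fun j => U n j w)) K)
    (fun n => (ln n%:R / n%:R) `^ alpha^-1).
Proof.
have [D dE] : exists D, d = D.+1 by exists d.-1; rewrite prednK.
subst d.
have [rb rb0 Krb] := convex_body_bounded hK.
have [a Ka [r r0 har]] := support_interior hK.
pose k : R := D.+1%:R; have k0 : 0 < k by rewrite ltr0n.
(* The failure probability for the directions, of order
   n ^ ((d - 1) / alpha) * n ^ (- C / (2 d)), tends to 0 thanks to this bound. *)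
have CK : 2 * k ^+ 2 / alpha <= C.
  apply: le_trans (ltW hC); rewrite -/k mulrAC -[leLHS]mulr1.
  rewrite ler_wpM2l ?mulr_ge0 ?invr_ge0 ?(ltW halpha)// -[leLHS](powRr0 8).
  by apply: ler_powR; rewrite ?ler1n// divr_ge0// subr_ge0 ler1n.
have C0 : 0 <= C.
  by apply: le_trans CK; rewrite divr_ge0 ?(ltW halpha)// mulr_ge0// sqr_ge0.
(* The depth b * rate of the caps is chosen so that a cap is missed by all
   the points with probability at most n ^ (- d / alpha). *)
pose b := (k / (alpha * L)) `^ alpha^-1.
have b0 : 0 < b by rewrite powR_gt0// divr_gt0// mulr_gt0.
have bE : L * b `^ alpha = k / alpha.
  rewrite /b -powRrM mulVf ?gt_eqF// powRr1; last first.
    by rewrite divr_ge0 ?mulr_ge0 ?(ltW k0) ?(ltW halpha) ?(ltW hL).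
  by field; rewrite !gt_eqF.
pose w1 := 4 * k ^+ 2; pose w2 := b + 2 * rb * w1.
have w10 : 0 < w1 by rewrite mulr_gt0// exprn_gt0.
have w20 : 0 < w2 by rewrite addr_gt0// !mulr_gt0.
move=> eta eta0.
pose B := 8 * rb * w1 + 2 * rb * w2 / r; exists B.
have : \forall n \near \oo, exists E : set T, [/\ measurable E,
    [set w | (B * rate alpha n)%:E < `|hausdorff_dist
      (khat n (num_dir D.+1 alpha C n) (fun i => X i w) (fun j => U n j w)) K|]%E
      `<=` E & (P E <= eta%:E)%E]; last by case=> N _ HN; exists N.
have small c : 0 < c -> \forall n \near \oo, rate alpha n <= c by exact: rate_small.
near=> n.
have l1 : 1 <= ln (n%:R : R) by near: n; exact: ln_nat_ge1.
have n2 : (2 <= n)%N by near: n; exists 2%N.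
have rho0 : 0 < rate alpha n := rate_gt0 alpha l1.
have rho1 : rate alpha n <= 1 by near: n; exact: small.
have rho_eps : b * rate alpha n <= eps0.
  by rewrite mulrC -ler_pdivlMr//; near: n; apply: small; rewrite divr_gt0.
have rho_delta : w1 * rate alpha n <= 1 / 4.
  by rewrite mulrC -ler_pdivlMr//; near: n; apply: small; rewrite divr_gt0.
have rho_r : w2 * rate alpha n <= r.
  by rewrite mulrC -ler_pdivlMr//; near: n; apply: small; rewrite divr_gt0.
have rho_eta : 4 * k * rate alpha n <= eta.
  rewrite mulrC -ler_pdivlMr ?mulr_gt0//; near: n; apply: small.
  by rewrite divr_gt0// mulr_gt0.
set rho := rate alpha n in rho0 rho1 rho_eps rho_delta rho_r rho_eta *.
have n0 : (0 < n)%N by exact: leq_trans n2.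
have nR : (0 : R) < n%:R by rewrite ltr0n.
(* A grid of mesh 2 / m, with m the integer part of 1 / rho. *)
pose m := Num.truncn rho^-1.
have /andP[mle mgt] : m%:R <= rho^-1 < m.+1%:R.
  by apply: truncn_itv; rewrite invr_ge0 ltW.
have m0 : (0 < m)%N.
  rewrite -(ltr_nat R) -[X in _ < X](addrK 1) natr1 ltrBrDr add0r.
  by rewrite (le_lt_trans _ mgt)// invf_ge1.
have m0R : (0 : R) < m%:R by rewrite ltr0n.
have [I [v [cardI v1 net0]]] := @sphere_net R D m m0.
have net u : sphere u -> exists c, enorm (u - v c) <= w1 * rho.
  move=> /net0[c uc]; exists c; apply: (le_trans uc); rewrite -/k ler_pdivrMr//.
  have : 1 <= rho * (2 * m%:R).
    rewrite -ler_pdivrMl// mulr1 (le_trans (ltW mgt))//.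
    by rewrite mulr_natl mulr2n -natr1 lerD// ler1n.
  have k2 : 0 <= 2 * k ^+ 2 by rewrite mulr_ge0// sqr_ge0.
  by move=> /(ler_wpM2l k2); rewrite /w1; lra.
set M := num_dir D.+1 alpha C n.
pose q := L * (b * rho) `^ alpha.
have q0 : 0 <= q by rewrite mulr_ge0 ?powR_ge0// ltW.
have capq c : (q%:E <= mu (cap K (v c) (b * rho)))%E.
  by apply: hcap => //; rewrite rho_eps mulr_ge0 ?ltW.
have [E [mE PE hE]] :=
  good_sample_probability n hK hX hmuK (hU n n2) hsigma v1 net q0 capq.
have IE : #|I|%:R = 2 * k * m%:R ^+ D :> R by rewrite cardI !natrM natrX.
have I0 : (0 : R) < #|I|%:R by rewrite IE !mulr_gt0// exprn_gt0.
have mD : m%:R ^+ D <= rho^-1 ^+ D.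
  by apply: lerXn2r; rewrite ?nnegrE ?invr_ge0 ?(ltW rho0).
have Irho : #|I|%:R <= 2 * k * rho^-1 ^+ D.
  by rewrite IE ler_wpM2l ?mulr_ge0 ?(ltW k0).
have PU : #|I|%:R * expR (- (M%:R * #|I|%:R^-1)) <= 2 * k * rho.
  apply: net_union_bound => //.
  rewrite ler_pdivlMr// (le_trans _ (num_dir_ge D halpha C0 l1))//.
  rewrite -/rho -/k; apply: (@le_trans _ _ (C * ln n%:R * m%:R ^+ D)); last first.
    by rewrite ler_wpM2l// mulr_ge0// (le_trans _ l1).
  rewrite IE mulrA ler_wpM2r ?exprn_ge0// ?(ltW m0R)//.
  rewrite mulrAC ler_wpM2r ?(le_trans _ l1)// (le_trans _ CK)//.
  by rewrite le_eqVlt; apply/orP; left; apply/eqP; ring.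
have PX : #|I|%:R * expR (- (n%:R * q)) <= 2 * k * rho.
  apply: net_union_bound => //.
  have l0 : 0 <= ln n%:R / n%:R :> R by rewrite divr_ge0 ?(le_trans _ l1)// ltW.
  rewrite /q powRM ?(ltW b0) ?(ltW rho0)// [L * _]mulrA bE.
  rewrite /rho /rate -powRrM mulVf ?gt_eqF//.
  rewrite powRr1// -/k le_eqVlt; apply/orP; left; apply/eqP.
  by field; rewrite !gt_eqF.
exists E; split => //.
  move=> w /= Bw; apply: contrapT => /hE good.
  have e0 : 0 <= b * rho by rewrite mulr_ge0 ?ltW.
  have er : b * rho + 2 * rb * (w1 * rho) <= r by move: rho_r; rewrite /w2; lra.
  have delta01 : 0 <= w1 * rho <= 1 / 4 by rewrite rho_delta mulr_ge0 ?ltW.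
  have := good_sample_hausdorff hK Ka har r0 Krb net delta01 e0 er n0 good.
  have -> : 8 * rb * (w1 * rho) + 2 * rb * (b * rho + 2 * rb * (w1 * rho)) / r = B * rho.
    by rewrite /B /w2; ring.
  rewrite leNgt => /negP; apply; rewrite -[ltRHS]gee0_abs//.
  by apply: hausdorff_dist_ge0; exists a.
apply: (le_trans PE); rewrite lee_fin (le_trans _ rho_eta)//.
by rewrite (le_trans (lerD PU PX))//; lra.
Unshelve. all: by end_near.
Qed.
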